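(* Every realizable target pair $(H_w,H_r)$ has a realization using at most $$N^*=\sum_{n\in\mathcal V_w}n+\sum_{m\in\mathcal V_r}m$$ items. The same holds with a cardinality cap: for every integer $K\ge1$, every pair realizable at cap $K$ has a realization at cap $K$ using at most $N^*$ items.
   Context: An instance consists of a finite set $E$ of items with rational values $a_i\ge 0$, positive integer sizes $d_i$, and integer capacities $0\le R<D$, with $d_i\le D$ for every item. Write $G(S)=\sum_{i\in S}a_i$ and $d(S)=\sum_{i\in S}d_i$. For $\alpha\in\{w,r\}$ let $U^\alpha(n)$ be the maximum of $G(S)$ over $n$-element admissible sets $S\subseteq E$, with value $-\infty$ if there is none; $U^\alpha(0)=0$. In the uncapped model $S$ is admissible if $d(S)\le D$ (for $\alpha=w$) or $d(S)\le R$ (for $\alpha=r$). At an integer cap $K\ge1$ one requires in addition $|S|\le K$ for $\alpha=w$ and $|S|\le K-1$ for $\alpha=r$. The terminal count is $b_\alpha=\min\operatorname{arg\,max}_n U^\alpha(n)$. The hull is the sequence on $\{0,\dots,b_\alpha\}$ obtained by evaluating at integers the upper concave hull of the points $(n,U^\alpha(n))$, $0\le n\le b_\alpha$. A target pair $(H_w,H_r)$ consists of strictly increasing concave rational sequences $H_\alpha$ on $\{0,\dots,b_\alpha\}$ with $H_\alpha(0)=0$ (the zero sequence $(0)$, with $b_\alpha=0$, is allowed). It is realizable (respectively realizable at cap $K$) if a single instance (its realization) has terminal counts $b_w,b_r$ and hulls exactly $H_w,H_r$ in the uncapped model (respectively at cap $K$). $\mathcal V_\alpha$ is the set of positive vertices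 of $H_\alpha$: the positive counts $n\le b_\alpha$ such that $n=b_\alpha$ or the slopes of $H_\alpha$ immediately before and after $n$ differ. *)

(* Defs.v *)
From HB Require Import structures.
From mathcomp Require Import all_boot all_order all_algebra.
From mathcomp Require Import constructive_ereal.

Set Implicit Arguments.
Unset Strict Implicit.
Unset Printing Implicit Defensive.

Import Order.TTheory GRing.Theory Num.Theory.
Local Open Scope ring_scope.

Record instance := Instance {
  item : finType;
  value : item -> rat;
  weight : item -> nat;
  capR : nat;
  capD : nat;
  value_ge0 : forall i, 0 <= value i;
  weight_gt0 : forall i, (0 < weight i)%N;
  capR_lt_capD : (capR < capD)%N;
  weight_le_capD : forall i, (weight i <= capD)%N
}.

Variant side := Side_w | Side_r.

Definition gain (I : instance) (S : {set item I}) : rat :=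
  \sum_(i in S) value i.

Definition load (I : instance) (S : {set item I}) : nat :=
  (\sum_(i in S) weight i)%N.

Definition capacity (I : instance) (al : side) : nat :=
  match al with Side_w => capD I | Side_r => capR I end.

(* [None] is the uncapped model, [Some K] the model at cardinality cap [K];  *)
(* the latter is only meant for [1 <= K], so that [K.-1] is a true K - 1.    *)
Definition within_cap (cap : option nat) (al : side) (n : nat) : bool :=
  match cap, al with
  | None, _ => true
  | Some K, Side_w => (n <= K)%N
  | Some K, Side_r => (n <= K.-1)%N
  end.

Definition admissible (cap : option nat) (I : instance) (al : side)
    (S : {set item I}) : bool :=
  (load S <= capacity I al)%N && within_cap cap al #|S|.

(* The value at 0 is always 0, since the empty set is admissible.            *)
Definition U (cap : option nat) (I : instance) (al : side) (n : nat) :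
    \bar rat :=
  \big[Order.max/-oo%E]_(S : {set item I} | admissible cap al S && (#|S| == n))
    (gain S)%:E.

Definition argmax (u : nat -> \bar rat) (n : nat) : Prop :=
  forall m, (u m <= u n)%E.

Definition terminal_count (u : nat -> \bar rat) (b : nat) : Prop :=
  argmax u b /\ forall n, argmax u n -> (b <= n)%N.

(* (x, y) is a convex combination of the points (n, u n), n <= b, where      *)
(* u n = -oo means that there is no point at abscissa n.                     *)
Definition conv_hull (u : nat -> \bar rat) (b : nat) (x y : rat) : Prop :=
  exists w : 'I_b.+1 -> rat,
    [/\ forall n, 0 <= w n,
        forall n : 'I_b.+1, u n = -oo%E -> w n = 0,
        \sum_n w n = 1,
        \sum_n w n * (n : nat)%:R = x
      & \sum_n w n * fine (u n) = y].

(* The upper concave hull is the upper boundary of the convex hull: its      *)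
(* value at x is y.                                                          *)
Definition upper_hull (u : nat -> \bar rat) (b : nat) (x y : rat) : Prop :=
  conv_hull u b x y /\ forall y', conv_hull u b x y' -> y' <= y.

(* A sequence on {0, ..., b} is given by b and a function nat -> rat, whose  *)
(* values above b are never used.                                            *)
Definition is_hull (u : nat -> \bar rat) (b : nat) (H : nat -> rat) : Prop :=
  forall n, (n <= b)%N -> upper_hull u b n%:R (H n).

Definition target (b : nat) (H : nat -> rat) : Prop :=
  [/\ H 0%N = 0,
      forall m n, (m < n)%N -> (n <= b)%N -> H m < H n
    & forall n, (n.+2 <= b)%N -> H n.+2 - H n.+1 <= H n.+1 - H n].

Definition target_pair (bw : nat) (Hw : nat -> rat) (br : nat)
    (Hr : nat -> rat) : Prop :=
  target bw Hw /\ target br Hr.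

Definition realization (cap : option nat) (bw : nat) (Hw : nat -> rat)
    (br : nat) (Hr : nat -> rat) (I : instance) : Prop :=
  [/\ terminal_count (U cap I Side_w) bw,
      terminal_count (U cap I Side_r) br,
      is_hull (U cap I Side_w) bw Hw
    & is_hull (U cap I Side_r) br Hr].

Definition realizable (cap : option nat) (bw : nat) (Hw : nat -> rat)
    (br : nat) (Hr : nat -> rat) : Prop :=
  exists I : instance, realization cap bw Hw br Hr I.

Definition vertex (b : nat) (H : nat -> rat) (n : nat) : bool :=
  (0 < n <= b)%N && ((n == b) || (H n - H n.-1 != H n.+1 - H n)).

Definition Nstar (bw : nat) (Hw : nat -> rat) (br : nat) (Hr : nat -> rat) :
    nat :=
  (\sum_(n < bw.+1 | vertex bw Hw n) n + \sum_(m < br.+1 | vertex br Hr m) m)%N.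

(* Main.v *)
Require Import Defs.
From mathcomp Require Import all_boot all_order all_algebra.
From mathcomp Require Import constructive_ereal lra.

(** The hull of an instance is pinned down by the points above its breakpoints,
    that is, 0 and the vertices: between two consecutive breakpoints it is a
    segment.  At a breakpoint a line touches the hull at that abscissa only, so
    the only convex combination of points reaching the hull there is the point
    itself ([breakpoint_attained]): an admissible set of exactly [n] items has
    gain [H n].  Keep one such set for every breakpoint of both hulls and
    delete all other items; the union of the kept sets has at most [Nstar]
    items.

    Deleting items only lowers the values of [U] ([U_restrict_le]), and keeps
    them at the breakpoints ([U_restrict_ge]).  Lower values cannot raise the
    hull, and the points at the breakpoints already generate all of it
    ([hull_from_breakpoints]).  The last breakpoint is the terminal count,
    whose value stays maximal, and no smaller count can become maximal
    ([terminal_count_le]).  Admissibility of a set depends only on its load and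
    cardinality, so a cardinality cap changes nothing in the argument. *)

Set Implicit Arguments.
Unset Strict Implicit.
Unset Printing Implicit Defensive.

Import Order.TTheory GRing.Theory Num.Theory.
Local Open Scope ring_scope.

(** * Concave sequences and their breakpoints *)

(** Including 0 makes every count at most [b] lie between two breakpoints; it
    adds nothing to the sum of the breakpoints. *)
Definition breakpoint (b : nat) (H : nat -> rat) (n : nat) : bool :=
  (n == 0%N) || vertex b H n.

Lemma breakpoint_last b H : breakpoint b H b.
Proof. by rewrite /breakpoint /vertex leqnn eqxx; case: b. Qed.

Section Concave.

Variables (b : nat) (H : nat -> rat).
Hypothesis tgtH : target b H.

Lemma slope_nonincreasing i m : (i + m < b)%N ->
  H (i + m).+1 - H (i + m)%N <= H i.+1 - H i.
Proof.
have [_ _ concH] := tgtH; elim: m => [|m IHm] lt_im; first by rewrite addn0.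
rewrite addnS in lt_im *; apply: le_trans (IHm (ltnW lt_im)).
exact: concH.
Qed.

Lemma le_right_slope n m : (n + m <= b)%N ->
  H (n + m)%N <= H n + m%:R * (H n.+1 - H n).
Proof.
elim: m => [|m IHm] le_nm; first by rewrite addn0 mul0r addr0.
rewrite addnS in le_nm *.
have := slope_nonincreasing le_nm; have := IHm (ltnW le_nm).
rewrite -(natr1 m); lra.
Qed.

Lemma le_left_slope k m : (k + m.+1 <= b)%N ->
  H k <= H (k + m.+1)%N - m.+1%:R * (H (k + m.+1)%N - H (k + m)%N).
Proof.
elim: m k => [|m IHm] k; first by rewrite addn1 addn0; lra.
rewrite !addnS => lt_kmb; have := @slope_nonincreasing k m.+1.
have := IHm k.+1; rewrite !addSn !addnS -(natr1 m.+1).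
by move=> /(_ lt_kmb) + /(_ lt_kmb); lra.
Qed.

(** At an interior breakpoint the mean of the two distinct adjacent slopes
    separates them strictly.  At the end points one slope is missing: a slope
    above the first one works at 0, and the slope 0 works at [b] because [H]
    increases strictly. *)
Lemma breakpoint_strict_support n : (n <= b)%N -> breakpoint b H n ->
  exists s : rat, forall k, (k <= b)%N -> k != n ->
    H k < H n + s * (k%:R - n%:R).
Proof.
have [_ incH concH] := tgtH => le_nb.
case: n => [_|n] in le_nb *.
  exists (H 1%N - H 0%N + 1) => k le_kb k_neq0.
  have k_gt0 : 0 < k%:R :> rat by rewrite ltr0n lt0n.
  by have := @le_right_slope 0 k le_kb; rewrite add0n; lra.
have [<- _|neq_nb] := eqVneq n.+1 b.
  exists 0 => k le_kn neq_kn; rewrite mul0r addr0.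
  by apply: incH; rewrite // ltn_neqAle neq_kn.
rewrite /breakpoint /vertex le_nb (negPf neq_nb) /= => neq_slopes.
have lt_nb : (n.+1 < b)%N by rewrite ltn_neqAle neq_nb.
have lt_slopes : H n.+2 - H n.+1 < H n.+1 - H n.
  by rewrite lt_neqAle eq_sym neq_slopes concH.
exists ((H n.+2 - H n) / 2%:R) => k le_kb.
rewrite neq_ltn => /orP[lt_kn|lt_nk].
- have [m def_n] : exists m, n = (k + m)%N.
    by exists (n - k)%N; rewrite subnKC // -ltnS.
  have := @le_left_slope k m; rewrite addnS -def_n => /(_ le_nb).
  have -> : n.+1%:R = k%:R + m.+1%:R :> rat by rewrite -natrD addnS -def_n.
  have m_gt0 : 0 < m.+1%:R :> rat by rewrite ltr0n.
  move: lt_slopes m_gt0; move: (m.+1%:R : rat) => x; nra.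
- have [m def_k] : exists m, k = (n.+1 + m.+1)%N.
    by exists (k - n.+2)%N; rewrite addnS -addSn subnKC.
  rewrite def_k in le_kb *; have := le_right_slope le_kb.
  have m_gt0 : 0 < m.+1%:R :> rat by rewrite ltr0n.
  rewrite (natrD _ n.+1).
  move: lt_slopes m_gt0; move: (m.+1%:R : rat) => x; nra.
Qed.

End Concave.

Lemma linear_between_breakpoints b H p m : (p + m <= b)%N ->
  (forall k, (p < k < p + m)%N -> ~~ breakpoint b H k) ->
  forall j, (j <= m)%N -> H (p + j)%N = H p + j%:R * (H p.+1 - H p).
Proof.
move=> le_pmb no_break j le_jm.
have slope i : (i < m)%N -> H (p + i).+1 - H (p + i)%N = H p.+1 - H p.
  elim: i => [|i IHi] lt_im; first by rewrite addn0.
  have lt_pim : (p + i.+1 < p + m)%N by rewrite ltn_add2l.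
  have := no_break (p + i.+1)%N.
  rewrite lt_pim addnS ltnS leq_addr /breakpoint /vertex => /(_ isT) /=.
  rewrite -addnS (leq_trans (ltnW lt_pim) le_pmb) /= negb_or negbK.
  by case/andP => _ /eqP; rewrite !addnS /= IHi // ltnW.
elim: j le_jm => [|j IHj] lt_jm; first by rewrite addn0 mul0r addr0.
have := IHj (ltnW lt_jm); have := slope _ lt_jm.
by rewrite addnS -(natr1 j); lra.
Qed.

(** * Hulls and the points at the breakpoints *)

Lemma conv_hull_point (u : nat -> \bar rat) b (k : 'I_b.+1) : u k <> -oo%E ->
  conv_hull u b k%:R (fine (u k)).
Proof.
move=> uk; exists (fun i => (i == k)%:R).
have delta (f : 'I_b.+1 -> rat) : \sum_i (i == k)%:R * f i = f k.
  rewrite (bigD1 k) //= eqxx mul1r big1 ?addr0 // => i /negPf->.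
  by rewrite mul0r.
split=> [i|i ui|||].
- by rewrite ler0n.
- by have [eq_ik|//] := eqVneq i k; rewrite eq_ik in ui.
- by rewrite -[RHS](delta (fun=> 1)); apply: eq_bigr => i _; rewrite mulr1.
- exact: delta.
- exact: delta.
Qed.

Lemma conv_hull_segment u b x1 y1 x2 y2 t : 0 <= t <= 1 ->
  conv_hull u b x1 y1 -> conv_hull u b x2 y2 ->
  conv_hull u b ((1 - t) * x1 + t * x2) ((1 - t) * y1 + t * y2).
Proof.
move=> /andP[t_ge0 t_le1] [w1 [w1_ge0 w1_oo w1_1 w1x w1y]].
move=> [w2 [w2_ge0 w2_oo w2_1 w2x w2y]].
exists (fun i => (1 - t) * w1 i + t * w2 i).
have comb (f : 'I_b.+1 -> rat) : \sum_i ((1 - t) * w1 i + t * w2 i) * f i =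
    (1 - t) * (\sum_i w1 i * f i) + t * (\sum_i w2 i * f i).
  rewrite !mulr_sumr -big_split /=; apply: eq_bigr => i _.
  by rewrite mulrDl !mulrA.
split=> [i|i ui|||].
- by rewrite addr_ge0 // mulr_ge0 ?subr_ge0.
- by rewrite w1_oo // w2_oo // !mulr0 addr0.
- by rewrite big_split /= -!mulr_sumr w1_1 w2_1; lra.
- by rewrite comb w1x w2x.
- by rewrite comb w1y w2y.
Qed.

(** A line that touches the hull only above [n] lies strictly above all other
    points, so a combination of points on the line has no weight outside
    [n]. *)
Lemma breakpoint_attained (u : nat -> \bar rat) b H n : target b H -> is_hull u b H ->
  (forall k, u k <> +oo%E) -> (n <= b)%N -> breakpoint b H n ->
  u n = (H n)%:E.
Proof.
move=> tgtH hullH u_noo le_nb brk_n.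
have [s supp] := breakpoint_strict_support tgtH le_nb brk_n.
have [[w [w_ge0 w_oo w_1 w_x w_y]] _] := hullH _ le_nb.
have fine_le (k : 'I_b.+1) : u k <> -oo%E -> fine (u k) <= H k.
  move=> uk; have [_ hull_max] := hullH k (leq_ord k).
  exact/hull_max/conv_hull_point.
have gap (k : 'I_b.+1) : k != n :> nat -> u k <> -oo%E ->
    0 < H n + s * (k%:R - n%:R) - fine (u k).
  move=> neq_kn uk; rewrite subr_gt0.
  exact: le_lt_trans (fine_le k uk) (supp k (leq_ord k) neq_kn).
pose slack (k : 'I_b.+1) := w k * (H n + s * (k%:R - n%:R) - fine (u k)).
have slack_ge0 k : 0 <= slack k.
  have [uk|/eqP uk] := eqVneq (u k) -oo%E; first by rewrite /slack w_oo ?mul0r.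
  rewrite mulr_ge0 // ?subr_ge0; have [eq_kn|neq_kn] := eqVneq (k : nat) n.
    by have := fine_le k uk; rewrite eq_kn subrr mulr0 addr0.
  by rewrite -subr_ge0 ltW // gap.
have sum_slack : \sum_k slack k = 0.
  have -> : \sum_k slack k = \sum_k w k * (H n - s * n%:R)
      + \sum_k s * (w k * k%:R) - \sum_k w k * fine (u k).
    rewrite -big_split -sumrB /=; apply: eq_bigr => k _; rewrite /slack; lra.
  by rewrite -mulr_suml w_1 -mulr_sumr w_x w_y; lra.
have w0 (k : 'I_b.+1) : k != n :> nat -> w k = 0.
  move=> neq_kn; have [uk|/eqP uk] := eqVneq (u k) -oo%E; first exact: w_oo.
  have := psumr_eq0P (fun k _ => slack_ge0 k) sum_slack (i := k) isT.
  by move/eqP; rewrite mulf_eq0 (gt_eqF (gap k neq_kn uk)) orbF => /eqP.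
pose n' : 'I_b.+1 := Ordinal (le_nb : (n < b.+1)%N).
have w_n : w n' = 1.
  by rewrite -w_1 (bigD1 n') //= big1 ?addr0 // => k; exact: w0.
have : fine (u n) = H n.
  rewrite -w_y (bigD1 n') //= big1 ?addr0 ?w_n ?mul1r // => k neq_kn.
  by rewrite w0 ?mul0r.
have := w_oo n'; have := u_noo n; rewrite w_n /=.
case: (u n) => [r _ _ /= -> //|//|_ /(_ erefl)/eqP].
by rewrite oner_eq0.
Qed.

(** Non-breakpoints lie on a segment between the nearest breakpoints on both
    sides, which exist because 0 and [b] are breakpoints. *)
Lemma conv_hull_from_breakpoints (u : nat -> \bar rat) b H n :
  (forall k, (k <= b)%N -> breakpoint b H k -> u k = (H k)%:E) ->
  (n <= b)%N -> conv_hull u b n%:R (H n).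
Proof.
move=> u_brk le_nb.
have at_brk k : (k <= b)%N -> breakpoint b H k -> conv_hull u b k%:R (H k).
  move=> le_kb brk_k; have uk := u_brk k le_kb brk_k.
  have := @conv_hull_point u b (Ordinal (le_kb : (k < b.+1)%N)).
  by rewrite /= uk; apply.
have [brk_n|nbrk_n] := boolP (breakpoint b H n); first exact: at_brk.
have exq : exists q, breakpoint b H q && (n <= q)%N.
  by exists b; rewrite breakpoint_last.
have exp : exists p, breakpoint b H p && (p <= n)%N by exists 0%N.
have bdp p : breakpoint b H p && (p <= n)%N -> (p <= n)%N by case/andP.
case: (ex_minnP exq) => q /andP[brk_q le_nq] min_q.
case: (ex_maxnP exp bdp) => p /andP[brk_p le_pn] max_p.
have lt_pn : (p < n)%N.
  by rewrite ltn_neqAle le_pn andbT; apply: contraNneq nbrk_n => <-.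
have le_qb : (q <= b)%N by apply: min_q; rewrite breakpoint_last.
have le_pq := leq_trans le_pn le_nq.
have no_break k : (p < k < p + (q - p))%N -> ~~ breakpoint b H k.
  rewrite subnKC // => /andP[lt_pk lt_kq]; apply/negP => brk_k.
  have [le_nk|lt_kn] := leqP n k.
    by have := min_q k; rewrite brk_k le_nk leqNgt lt_kq => /(_ isT).
  by have := max_p k; rewrite brk_k ltnW // leqNgt lt_pk => /(_ isT).
have := linear_between_breakpoints _ no_break; rewrite subnKC // => /(_ le_qb).
move=> lin; have := lin _ (leqnn _); have := lin _ (leq_sub2r p le_nq).
rewrite !subnKC // !natrB // => Hn Hq.
have lt_pq : 0 < q%:R - p%:R :> rat.
  by rewrite subr_gt0 ltr_nat (leq_trans lt_pn).
have lt_pnR : 0 <= n%:R - p%:R :> rat by rewrite subr_ge0 ler_nat.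
have le_nqR : 0 <= q%:R - n%:R :> rat by rewrite subr_ge0 ler_nat.
pose t : rat := (n%:R - p%:R) / (q%:R - p%:R).
have tE : t * (q%:R - p%:R) = n%:R - p%:R by rewrite divfK ?gt_eqF.
have t01 : 0 <= t <= 1.
  by rewrite divr_ge0 ?(ltW lt_pq) //= ler_pdivrMr // mul1r; lra.
have := conv_hull_segment t01 (at_brk p (leq_trans le_pq le_qb) brk_p)
  (at_brk q le_qb brk_q).
have -> : (1 - t) * p%:R + t * q%:R = n%:R by lra.
by have -> : (1 - t) * H p + t * H q = H n by rewrite Hq Hn -tE; lra.
Qed.

Lemma hull_from_breakpoints (u u' : nat -> \bar rat) b H : is_hull u b H ->
  (forall k, u k <> +oo%E) -> (forall k, (u' k <= u k)%E) ->
  (forall k, (k <= b)%N -> breakpoint b H k -> u' k = (H k)%:E) ->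
  is_hull u' b H.
Proof.
move=> hullH u_noo le_u'u u'_brk n le_nb; split.
  exact: conv_hull_from_breakpoints.
move=> _ [w [w_ge0 w_oo w_1 w_x <-]].
have [_ hull_max] := hullH _ le_nb.
apply: (@le_trans _ _ (\sum_k w k * fine (u k))).
  apply: ler_sum => k _.
  have := w_oo k; have := u_noo k; have := le_u'u k; have := w_ge0 k.
  case: (u' k) (u k) => [r'||] [r||] //= wk_ge0; rewrite ?lee_fin.
  - by move=> le_rr' _ _; rewrite ler_wpM2l.
  - by move=> _ _ /(_ erefl)->; rewrite !mul0r.
apply: hull_max; exists w; split=> // k uk; apply: w_oo.
by apply/eqP; rewrite -leeNy_eq -uk.
Qed.

Lemma terminal_count_le (u u' : nat -> \bar rat) b : (forall k, (u' k <= u k)%E) ->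
  u' b = u b -> terminal_count u b -> terminal_count u' b.
Proof.
move=> le_u'u eq_b [max_b min_b]; split=> [n|n max_n].
  by rewrite eq_b; apply: le_trans (max_b n).
apply: min_b => m; apply: le_trans (max_b m) _; rewrite -eq_b.
exact: le_trans (max_n b) (le_u'u n).
Qed.

(** * Deleting items *)

Lemma U_ge cap I al (S : {set item I}) : admissible cap al S ->
  ((gain S)%:E <= U cap I al #|S|)%E.
Proof. by move=> admS; rewrite /U (le_bigmax_cond _ _) // admS /=. Qed.

Lemma U_attained cap I al n : U cap I al n = -oo%E \/
  exists S : {set item I}, [/\ admissible cap al S, #|S| = n
    & U cap I al n = (gain S)%:E].
Proof.
rewrite /U; elim/big_rec: _ => [|S x]; first by left.
case/andP=> admS /eqP cardS IHx; right.
have [_|lt_Sx] := leP x (gain S)%:E; first by exists S.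
by case: IHx lt_Sx => [->//|//].
Qed.

Lemma U_noo cap I al n : U cap I al n <> +oo%E.
Proof. by case: (U_attained cap I al n) => [->|[S [_ _ ->]]]. Qed.

Definition restrict (I : instance) (A : {set item I}) : instance :=
  @Instance {i : item I | i \in A}
    (fun i => value (val i)) (fun i => weight (val i)) (capR I) (capD I)
    (fun i => value_ge0 (val i)) (fun i => weight_gt0 (val i))
    (capR_lt_capD I) (fun i => weight_le_capD (val i)).

Section Restrict.

Variables (cap : option nat) (I : instance) (al : side) (A : {set item I}).

Definition unrestrict (S : {set item (restrict A)}) : {set item I} :=
  [set val (i : {i | i \in A}) | i in S].

Lemma gain_unrestrict S : gain (unrestrict S) = gain S.
Proof. by rewrite /gain big_imset //= => i j _ _; exact: val_inj. Qed.

Lemma card_unrestrict S : #|unrestrict S| = #|S|.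
Proof. by rewrite card_imset //; exact: val_inj. Qed.

Lemma admissible_unrestrict S :
  admissible cap al (unrestrict S) = admissible cap al S.
Proof.
rewrite /admissible card_unrestrict /load big_imset /=.
  by case: (al).
by move=> i j _ _; exact: val_inj.
Qed.

Lemma U_restrict_le n : (U cap (restrict A) al n <= U cap I al n)%E.
Proof.
case: (U_attained cap (restrict A) al n) => [->|]; first exact: leNye.
case=> S [admS <- ->]; rewrite -gain_unrestrict -card_unrestrict.
by apply: U_ge; rewrite admissible_unrestrict.
Qed.

Lemma U_restrict_ge (S : {set item I}) : S \subset A -> admissible cap al S ->
  ((gain S)%:E <= U cap (restrict A) al #|S|)%E.
Proof.
move=> /subsetP sSA.
pose S' : {set item (restrict A)} := [set i : {i | i \in A} | val i \in S].
have -> : S = unrestrict S'.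
  apply/setP=> i; apply/idP/imsetP => [Si|[j]].
    by exists (exist _ i (sSA i Si)); rewrite ?inE.
  by rewrite inE => Sj ->.
by rewrite admissible_unrestrict gain_unrestrict card_unrestrict; apply: U_ge.
Qed.

End Restrict.

(** * Keeping one optimal set for each breakpoint *)

Lemma leq_card_bigcup (T J : finType) (P : pred J) (F : J -> {set T}) :
  (#|\bigcup_(j | P j) F j| <= \sum_(j | P j) #|F j|)%N.
Proof.
elim/big_rec2: _ => [|j n X _ le_Xn]; first by rewrite cards0.
by rewrite (leq_trans (leq_card_setU _ _)) ?leq_add2l.
Qed.

Lemma sum_breakpoint b H : (\sum_(n < b.+1 | breakpoint b H n) n =
  \sum_(n < b.+1 | vertex b H n) n)%N.
Proof.
rewrite [LHS]big_mkcond [RHS]big_mkcond; apply: eq_bigr => n _.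
by rewrite /breakpoint; case: (n : nat) => [|m] //=; case: ifP.
Qed.

(** Any superset [B] of the kept items works, which is what lets one restricted
    instance serve both sides. *)
Lemma sparse_side cap I al b H : target b H ->
  terminal_count (U cap I al) b -> is_hull (U cap I al) b H ->
  exists A : {set item I},
    (#|A| <= \sum_(n < b.+1 | vertex b H n) n)%N /\
    forall B : {set item I}, A \subset B ->
      terminal_count (U cap (restrict B) al) b /\
      is_hull (U cap (restrict B) al) b H.
Proof.
move=> tgtH termb hullH; have noo := @U_noo cap I al.
have att n := breakpoint_attained tgtH hullH noo (n := n).
have opt (n : 'I_b.+1) : exists S : {set item I}, breakpoint b H n ->
    [/\ admissible cap al S, #|S| = n & gain S = H n].
  have [brk_n|_] := boolP (breakpoint b H n); last by exists set0.
  have Un := att n (leq_ord n) brk_n.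
  have [|[S [admS cardS]]] := U_attained cap I al n; rewrite Un // => -[HS].
  by exists S.
have [F optF] := fin_all_exists opt.
exists (\bigcup_(n < b.+1 | breakpoint b H n) F n); split=> [|B sFB].
  rewrite -sum_breakpoint (leq_trans (leq_card_bigcup _ _)) //.
  by apply: leq_sum => n /optF[_ ->].
have le_U := @U_restrict_le cap I al B.
have brk_U k : (k <= b)%N -> breakpoint b H k ->
    U cap (restrict B) al k = (H k)%:E.
  move=> le_kb brk_k; apply/le_anti/andP; split.
    by rewrite -(att k le_kb brk_k).
  have [admF cardF <-] := optF (Ordinal (le_kb : (k < b.+1)%N)) brk_k.
  rewrite -[X in U _ _ _ X]cardF; apply: U_restrict_ge => //.
  by apply: subset_trans sFB; exact: bigcup_sup.
split; last exact: hull_from_breakpoints hullH noo le_U brk_U.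
apply: terminal_count_le le_U _ termb.
by rewrite brk_U ?att ?breakpoint_last.
Qed.

Lemma sparse_realization cap bw Hw br Hr : target_pair bw Hw br Hr ->
  realizable cap bw Hw br Hr ->
  exists I : instance,
    realization cap bw Hw br Hr I /\ (#|item I| <= Nstar bw Hw br Hr)%N.
Proof.
move=> [tgtw tgtr] [I [termw termr hullw hullr]].
have [Aw [cardw keepw]] := sparse_side tgtw termw hullw.
have [Ar [cardr keepr]] := sparse_side tgtr termr hullr.
have [termw' hullw'] := keepw _ (subsetUl Aw Ar).
have [termr' hullr'] := keepr _ (subsetUr Aw Ar).
exists (restrict (Aw :|: Ar)); split=> //.
rewrite /= card_sig (leq_trans _ (leq_add cardw cardr)) //.
exact: leq_card_setU.
Qed.

Local Close Scope ring_scope.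

Theorem lemma3p8 (bw : nat) (Hw : nat -> rat) (br : nat) (Hr : nat -> rat) :
  target_pair bw Hw br Hr ->
  (realizable None bw Hw br Hr ->
   exists I : instance,
     realization None bw Hw br Hr I /\ #|item I| <= Nstar bw Hw br Hr)
  /\
  (forall K : nat, 1 <= K ->
   realizable (Some K) bw Hw br Hr ->
   exists I : instance,
     realization (Some K) bw Hw br Hr I /\ #|item I| <= Nstar bw Hw br Hr).
Proof.
move=> tgt; split=> [|K _]; exact: sparse_realization.
Qed.
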